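(* Let $f_1,\dots,f_N:\mathbb{R}^n\to\mathbb{R}^n$ be contracting similarities with ratios $\rho_1,\dots,\rho_N\in(0,1)$, and let $C\subset\mathbb{R}^n$ be a non-empty compact set such that the inhomogeneous IFS $\{f_1,\dots,f_N,C\}$ satisfies the inhomogeneous open set condition. Let $E$ be a sub-self-similar set for $\{f_1,\dots,f_N\}$ with $E=\Theta(S)$, where $S\subseteq I^\infty$ is compact and closed under left shift, let $O_S=C\cup\bigcup_{\omega\in S^*}f_\omega(C)$, and let $s\ge0$ be the unique non-negative number with $$\tau(s)=\lim_{k\to\infty}\Big(\sum_{\omega\in S^k}\rho_\omega^s\Big)^{1/k}=1.$$ Then $\dim_H(E\cup O_S)=\max\{s,\dim_H C\}$.
   Context: $\dim_H$ denotes Hausdorff dimension. A non-empty compact set $E$ is a sub-self-similar (SSS) set for $\{f_1,\dots,f_N\}$ if $E\subseteq\bigcup_{i=1}^N f_i(E)$. Inhomogeneous open set condition (IOSC) for $\{f_1,\dots,f_N,C\}$: there is a non-empty bounded open set $U\subset\mathbb{R}^n$ with $\bigcup_{i=1}^N f_i(U)\subseteq U$, $f_i(U)\cap f_j(U)=\emptyset$ for $i\ne j$, and $C\subset U$. Code space: $I=\{1,\dots,N\}$, $I^\infty$ is the set of infinite sequences in $I$ with the product topology. For a finite word $\omega=\omega_1\cdots\omega_m$ put $f_\omega=f_{\omega_1}\circ\cdots\circ f_{\omega_m}$ and $\rho_\omega=\rho_{\omega_1}\cdots\rho_{\omega_m}$. The coding map is $\Theta(\omega)=\lim_{m\to\infty}f_{\omega_1}\circ\cdots\circ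 f_{\omega_m}(x)$ (independent of $x$). $S$ is closed under left shift if $\omega_1\omega_2\omega_3\cdots\in S$ implies $\omega_2\omega_3\cdots\in S$. For $m\ge1$, $S^m=\{\omega_1\cdots\omega_m:\omega\in S\}$ and $S^*=\bigcup_{m\ge1}S^m$. The limit defining $\tau$ exists by submultiplicativity. *)

(* Defs.v *)
From mathcomp Require Import all_boot all_order all_algebra.
From mathcomp Require Import all_classical all_reals all_analysis.

Set Implicit Arguments.
Unset Strict Implicit.
Unset Printing Implicit Defensive.

Import Order.TTheory GRing.Theory Num.Theory.
Import numFieldNormedType.Exports.

Local Open Scope classical_set_scope.
Local Open Scope ring_scope.

(* The library norm on 'rV[R]_n is the sup norm. It induces the usual topology
   and the usual bounded sets, but similarities and diameters are metric
   notions, so they are stated with the Euclidean distance. *)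
Definition edist (R : realType) (n : nat) (x y : 'rV[R]_n) : R :=
  Num.sqrt (\sum_(i < n) (x 0 i - y 0 i) ^+ 2).

Definition contracting_similarity (R : realType) (n : nat)
    (f : 'rV[R]_n -> 'rV[R]_n) (r : R) : Prop :=
  0 < r < 1 /\ forall x y, edist (f x) (f y) = r * edist x y.

(* Equal to -oo on the empty set. *)
Definition diam (R : realType) (n : nat) (A : set 'rV[R]_n) : \bar R :=
  ereal_sup [set (edist x y)%:E | x in A & y in A].

(* |A|^t, with the value 0 on the empty set even when t = 0, so that the
   0-dimensional Hausdorff measure counts points. *)
Definition diam_pow (R : realType) (n : nat) (t : R) (A : set 'rV[R]_n) :
    \bar R :=
  if A == set0 then 0%E else poweR (diam A) t.

Definition delta_cover (R : realType) (n : nat) (d : R) (A : set 'rV[R]_n)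
    (U : nat -> set 'rV[R]_n) : Prop :=
  A `<=` \bigcup_i U i /\ forall i, (diam (U i) <= d%:E)%E.

Definition hausdorff_premeasure (R : realType) (n : nat) (t d : R)
    (A : set 'rV[R]_n) : \bar R :=
  ereal_inf [set (\sum_(0 <= i <oo) diam_pow t (U i))%E
            | U in delta_cover d A].

Definition hausdorff_measure (R : realType) (n : nat) (t : R)
    (A : set 'rV[R]_n) : \bar R :=
  ereal_sup [set hausdorff_premeasure t d A | d in [set d : R | 0 < d]].

Definition hausdorff_dim (R : realType) (n : nat) (A : set 'rV[R]_n) : \bar R :=
  ereal_inf [set t%:E | t in
    [set t : R | 0 <= t /\ hausdorff_measure t A = 0%E]].

Definition sub_self_similar (R : realType) (n N : nat)
    (f : 'I_N -> 'rV[R]_n -> 'rV[R]_n) (E : set 'rV[R]_n) : Prop :=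
  [/\ E !=set0, compact E & E `<=` \bigcup_i (f i @` E)].

Definition IOSC (R : realType) (n N : nat)
    (f : 'I_N -> 'rV[R]_n -> 'rV[R]_n) (C : set 'rV[R]_n) : Prop :=
  exists U : set 'rV[R]_n,
    [/\ U !=set0, open U & bounded_set U] /\
    [/\ \bigcup_i (f i @` U) `<=` U,
        forall i j, i != j -> (f i @` U) `&` (f j @` U) = set0
      & C `<=` U].

(* Sequences over {0, ..., N-1}, with the product of the discrete topologies. *)
Definition code_space (N : nat) : topologicalType :=
  {ptws nat -> discrete_topology 'I_N}.

Definition word_prefix (N : nat) (w : code_space N) (m : nat) : seq 'I_N :=
  mkseq w m.

Definition shift (N : nat) (w : code_space N) : code_space N :=
  fun i => w i.+1.

Definition shift_closed (N : nat) (S : set (code_space N)) : Prop :=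
  forall w, S w -> S (shift w).

Definition words (N : nat) (S : set (code_space N)) (m : nat) :
    set (seq 'I_N) :=
  [set word_prefix w m | w in S].

Definition nonempty_words (N : nat) (S : set (code_space N)) :
    set (seq 'I_N) :=
  \bigcup_(m in [set m | (1 <= m)%N]) words S m.

Definition word_map (R : realType) (n N : nat)
    (f : 'I_N -> 'rV[R]_n -> 'rV[R]_n) (w : seq 'I_N) :
    'rV[R]_n -> 'rV[R]_n :=
  foldr (fun i g => f i \o g) id w.

Definition word_ratio (R : realType) (N : nat) (rho : 'I_N -> R)
    (w : seq 'I_N) : R :=
  \prod_(i <- w) rho i.

(* For contractions the limit does not depend on the base point, here 0. *)
Definition coding_map (R : realType) (n N : nat)
    (f : 'I_N -> 'rV[R]_n -> 'rV[R]_n) (w : code_space N) : 'rV[R]_n :=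
  lim (word_map f (word_prefix w m) 0 @[m --> \oo]).

Definition orbital_set (R : realType) (n N : nat)
    (f : 'I_N -> 'rV[R]_n -> 'rV[R]_n) (C : set 'rV[R]_n)
    (S : set (code_space N)) : set 'rV[R]_n :=
  C `|` \bigcup_(w in nonempty_words S) (word_map f w @` C).

(* A sum over an infinite support would be 0 by convention; there is none
   here since [words S k] is finite, see [finite_words]. *)
Definition tau_seq (R : realType) (N : nat) (rho : 'I_N -> R)
    (S : set (code_space N)) (s : R) (k : nat) : R :=
  (\sum_(w \in words S k) word_ratio rho w `^ s) `^ (k%:R^-1).

Lemma finite_words (N : nat) (S : set (code_space N)) (m : nat) :
  finite_set (words S m).
Proof.
apply: (@sub_finite_set _ _ [set tval t | t in [set: m.-tuple 'I_N]]).
  move=> _ [w _ <-]; have sz : size (word_prefix w m) == m by rewrite size_mkseq.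
  by exists (Tuple sz).
exact/finite_image/finite_finset.
Qed.

(* Main.v *)
(* For [t > 0] a set is null for the [t]-dimensional Hausdorff measure iff it has
   countable covers by balls with arbitrarily small sum of the [radius ^ t]. For
   [t > s] such covers of [E] come from the words of [S] of a given length, and
   those of the orbital set from covers of [C], since the [f_w] are 1-Lipschitz.
   Conversely suppose that [E] is null for some [t > 0]. By the open set
   condition each ball of radius [r] meets the images of boundedly many words that
   stop at scale [r]; by compactness of [S] finitely many of these words meet
   every sequence of [S] in a prefix, and their sum of [rho_w ^ t] is at most 1. As
   [S] is closed under the shift, its words factor over this finite set, so the
   sums over [S^k] are bounded in [k], which forces [s <= t]. *)
Require Import Defs.
From mathcomp Require Import all_boot all_order all_algebra.
From mathcomp Require Import all_classical all_reals all_analysis.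
From mathcomp Require Import ring lra zify.
Import Order.TTheory GRing.Theory Num.Theory.
Import numFieldNormedType.Exports.
Local Open Scope classical_set_scope.
Local Open Scope ring_scope.

Set Implicit Arguments.
Unset Strict Implicit.
Unset Printing Implicit Defensive.

(* MathComp-Analysis exports an unrelated [edist] that would shadow this one. *)
Local Notation edist := Defs.edist.

(** * Euclidean similarities *)

(** Lagrange's identity: the double sum of squares below is twice the right-hand side minus twice
    the left-hand side. *)
Lemma Cauchy_Schwarz_sum (R : realFieldType) (n : nat) (a b : 'I_n -> R) :
  (\sum_i a i * b i) ^+ 2 <= (\sum_i a i ^+ 2) * (\sum_i b i ^+ 2).
Proof.
have : 0 <= \sum_i \sum_j (a i * b j - a j * b i) ^+ 2.
  by apply: sumr_ge0 => i _; apply: sumr_ge0 => j _; exact: sqr_ge0.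
have -> : \sum_i \sum_j (a i * b j - a j * b i) ^+ 2 =
    \sum_i \sum_j a i ^+ 2 * b j ^+ 2 + \sum_i \sum_j b i ^+ 2 * a j ^+ 2
    - 2 * \sum_i \sum_j (a i * b i) * (a j * b j).
  rewrite mulr_sumr -sumrN -!big_split /=; apply: eq_bigr => i _.
  rewrite mulr_sumr -sumrN -!big_split /=; apply: eq_bigr => j _; ring.
rewrite -!big_distrlr /= -expr2; lra.
Qed.

Section Euclidean.
Variables (R : realType) (n : nat).
Implicit Types x y z : 'rV[R]_n.



Lemma edist_ge0 x y : 0 <= edist x y.
Proof. exact: sqrtr_ge0. Qed.

Lemma edist_sqr x y : edist x y ^+ 2 = \sum_(i < n) (x 0 i - y 0 i) ^+ 2.
Proof. by rewrite sqr_sqrtr // sumr_ge0 // => i _; exact: sqr_ge0. Qed.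

Lemma edistC x y : edist x y = edist y x.
Proof. by congr Num.sqrt; apply: eq_bigr => i _; rewrite -sqrrN opprB. Qed.

Lemma edistxx x : edist x x = 0.
Proof.
by rewrite /edist big1 ?sqrtr0 // => i _; rewrite subrr expr0n.
Qed.

Lemma edist_triangle y x z : edist x z <= edist x y + edist y z.
Proof.
rewrite -(@ler_pXn2r _ 2) // ?nnegrE ?addr_ge0 ?edist_ge0 //.
rewrite sqrrD !edist_sqr.
have -> : \sum_i (x 0 i - z 0 i) ^+ 2 = \sum_i (x 0 i - y 0 i) ^+ 2
    + 2 * \sum_i (x 0 i - y 0 i) * (y 0 i - z 0 i) + \sum_i (y 0 i - z 0 i) ^+ 2.
  rewrite mulr_sumr -!big_split /=; apply: eq_bigr => i _; ring.
rewrite lerD2r lerD2l -(mulr_natl (_ * _)) ler_wpM2l // (le_trans (ler_norm _)) //.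
rewrite -(@ler_pXn2r _ 2) ?nnegrE ?mulr_ge0 ?edist_ge0 //.
by rewrite exprMn !edist_sqr real_normK ?num_real ?Cauchy_Schwarz_sum.
Qed.

Lemma coord_le_edist x y i : `|x 0 i - y 0 i| <= edist x y.
Proof.
rewrite -sqrtr_sqr ler_wsqrtr // (bigD1 i) //= lerDl.
by apply: sumr_ge0 => j _; exact: sqr_ge0.
Qed.

Lemma edist_le_sum x y : edist x y <= \sum_i `|x 0 i - y 0 i|.
Proof.
have s0 : 0 <= \sum_i `|x 0 i - y 0 i| by exact: sumr_ge0.
rewrite -(@ler_pXn2r _ 2) // ?nnegrE ?edist_ge0 // edist_sqr.
rewrite [in leRHS]expr2 mulr_suml; apply: ler_sum => i _.
rewrite -(@real_normK _ (x 0 i - y 0 i)) ?num_real // expr2 ler_wpM2l //.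
by rewrite (bigD1 i) //= lerDl sumr_ge0.
Qed.

Lemma ball_edist x y e : 0 < e -> edist x y < e -> ball x e y.
Proof.
move=> e0 xye; split => // i j; rewrite ord1.
by apply: le_lt_trans xye; rewrite coord_le_edist.
Qed.

Lemma edist_le_ball x y e : ball x e y -> edist x y <= n%:R * e.
Proof.
move=> [e0 xy]; apply: (le_trans (edist_le_sum _ _)).
apply: (@le_trans _ _ (\sum_(i < n) e)); last first.
  by rewrite sumr_const card_ord mulr_natl.
by apply: ler_sum => i _; exact/ltW/xy.
Qed.

End Euclidean.

Section Similarity.
Variables (R : realType) (n : nat) (g : 'rV[R]_n -> 'rV[R]_n) (r : R).
Hypotheses (r0 : 0 < r) (gr : forall x y, edist (g x) (g y) = r * edist x y).

Lemma edist_inj x y : edist x y = 0 -> x = y :> 'rV[R]_n.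
Proof.
move=> xy; apply/rowP => i; apply/eqP; rewrite -subr_eq0 -normr_le0 -xy.
exact: coord_le_edist.
Qed.

Lemma similarity_inj : injective g.
Proof.
move=> x y gxy; apply: edist_inj; have := gr x y.
by rewrite gxy edistxx => /esym/eqP; rewrite mulf_eq0 gt_eqF // => /eqP.
Qed.

(* By polarization [g - g 0] multiplies inner products by [r ^+ 2], so the
   images of the unit vectors are the rows of [r] times an orthogonal matrix,
   which inverts [g]. *)
Lemma similarity_surj y : exists x, g x = y.
Proof.
pose h x := g x - g 0.
have hdot u v : \sum_i h u 0 i * h v 0 i = r ^+ 2 * \sum_i u 0 i * v 0 i.
  have H a b : \sum_i (g a 0 i - g b 0 i) ^+ 2 =
      r ^+ 2 * \sum_i (a 0 i - b 0 i) ^+ 2.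
    by rewrite -!edist_sqr gr exprMn.
  have pol (a b c : 'rV[R]_n) : 2 * \sum_i (a 0 i - c 0 i) * (b 0 i - c 0 i) =
      \sum_i (a 0 i - c 0 i) ^+ 2 + \sum_i (b 0 i - c 0 i) ^+ 2
      - \sum_i (a 0 i - b 0 i) ^+ 2.
    rewrite mulr_sumr -sumrN -!big_split /=; apply: eq_bigr => i _; ring.
  have e1 : \sum_i h u 0 i * h v 0 i =
      \sum_i (g u 0 i - g 0 0 i) * (g v 0 i - g 0 0 i).
    by apply: eq_bigr => i _; rewrite !mxE.
  have e2 : \sum_i u 0 i * v 0 i =
      \sum_i (u 0 i - (0 : 'rV[R]_n) 0 i) * (v 0 i - (0 : 'rV[R]_n) 0 i).
    by apply: eq_bigr => i _; rewrite !mxE !subr0.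
  have := pol (g u) (g v) (g 0); have := pol u v 0.
  rewrite e1 e2 !H; nra.
pose G : 'M[R]_n := \matrix_(i, j) h (delta_mx 0 i) 0 j.
have r2 : r ^+ 2 != 0 by rewrite expf_neq0 ?gt_eqF.
have hG x : h x *m G^T = r ^+ 2 *: x.
  apply/rowP => i; rewrite [LHS]mxE [RHS]mxE.
  have -> : \sum_j h x 0 j * G^T j i = \sum_j h x 0 j * h (delta_mx 0 i) 0 j.
    by apply: eq_bigr => j _; congr (_ * _); rewrite !mxE.
  rewrite hdot (bigD1 i) //= mxE !eqxx mulr1 big1 ?addr0 // => j ji.
  by rewrite mxE eqxx /= (negPf ji) mulr0.
have GG : (r ^- 2 *: G) *m G^T = 1%:M.
  apply/row_matrixP => i; rewrite row_mul linearZ /= -scalemxAl.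
  have -> : row i G = h (delta_mx 0 i) by apply/rowP => j; rewrite !mxE.
  by rewrite hG scalerA mulVf // scale1r row1.
have /mulmx1C GG' := GG.
exists (r ^- 2 *: ((y - g 0) *m G^T)).
set x := _ *: _.
have : h x *m G^T = (y - g 0) *m G^T by rewrite hG scalerA divff // scale1r.
move=> /(congr1 (mulmx^~ (r ^- 2 *: G))); rewrite -!mulmxA GG' !mulmx1.
by rewrite /h => /addIr.
Qed.

End Similarity.

(* Pigeonhole on a grid of mesh [delta * r / n.+1]. *)
Lemma separated_points_bound (R : realType) (n : nat) (B delta : R) :
  0 < delta -> exists c : nat, forall (r : R) (T : eqType) (l : seq T)
    (y : T -> 'rV[R]_n) (z : 'rV[R]_n), 0 < r -> uniq l ->
  (forall a, a \in l -> edist (y a) z <= B * r) ->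
  (forall a b, a \in l -> b \in l -> a != b ->
    delta * r <= edist (y a) (y b)) ->
  (size l <= c)%N.
Proof.
move=> d0; pose q : R := n.+1%:R / delta.
have q0 : 0 < q by rewrite divr_gt0.
pose K := Num.truncn (2 * B * q).
exists #|{ffun 'I_n -> 'I_K.+1}| => r T l y z r0 ul lB ld.
have qr0 : 0 < q / r by rewrite divr_gt0.
(* For [a] in [l], the coordinates of [y a] in units of the mesh [r / q], measured from the corner
   of the cube of half-side [B * r] about [z]; they lie between [0] and [2 * B * q]. *)
pose u a i := (y a 0 i - z 0 i + B * r) * (q / r).
have u_ge0 a i : a \in l -> 0 <= u a i.
  move=> al; rewrite mulr_ge0 ?(ltW qr0) //.
  have := coord_le_edist (y a) z i; have := lB _ al.
  by rewrite ler_norml; move=> ? /andP[? ?]; lra.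
have u_lt a i : a \in l -> (Num.truncn (u a i) < K.+1)%N.
  move=> al; rewrite ltnS le_truncn //.
  have -> : 2 * B * q = (2 * B * r) * (q / r).
    by field; rewrite gt_eqF.
  rewrite ler_wpM2r ?(ltW qr0) //.
  have := coord_le_edist (y a) z i; have := lB _ al.
  by rewrite ler_norml; move=> ? /andP[? ?]; lra.
pose h a : {ffun 'I_n -> 'I_K.+1} := [ffun i => inord (Num.truncn (u a i))].
rewrite -(size_map h l) cardE; apply: uniq_leq_size => [|? _]; last first.
  by rewrite mem_enum.
rewrite map_inj_in_uniq // => a b al bl /ffunP hab; apply/eqP/negPn/negP => ab.
have := ld _ _ al bl ab; apply/negP; rewrite -ltNge.
have e0 : 0 < r / q by rewrite divr_gt0.
(* Points of one cell differ by less than the mesh in each coordinate. The factor n / (n + 1) keeps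
   their distance strictly below [delta * r], also for n = 0. *)
apply: (@le_lt_trans _ _ (n%:R * (r / q))); last first.
  have -> : n%:R * (r / q) = n%:R / n.+1%:R * (delta * r).
    by rewrite /q; field; rewrite !gt_eqF //= ?ltr0n.
  by rewrite gtr_pMl ?mulr_gt0 // ltr_pdivrMr // mul1r ltr_nat.
apply: edist_le_ball; split => // i j; rewrite ord1 => {i}.
have := hab j; rewrite !ffunE => /(congr1 val) /=.
rewrite !inordK ?u_lt // => tab.
have /andP[a1 a2] := truncn_itv (u_ge0 a j al).
have /andP[b1 b2] := truncn_itv (u_ge0 b j bl).
rewrite tab in a1 a2; rewrite -natr1 in a2 b2.
have : `|u a j - u b j| < 1 by rewrite ltr_norml; apply/andP; split; lra.
have -> : u a j - u b j = (y a 0 j - y b 0 j) * (q / r) by rewrite /u; ring.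
rewrite normrM (gtr0_norm qr0) -ltr_pdivlMr //.
by rewrite mul1r invf_div.
Qed.

(** * Words and coding *)

Section WordRatios.
Variables (R : realType) (N : nat) (rho : 'I_N -> R).
Hypothesis rho01 : forall i, 0 < rho i < 1.
Implicit Types (u v w : seq 'I_N).

Lemma ratio_gt0 i : 0 < rho i.
Proof. by case/andP: (rho01 i). Qed.

Lemma word_ratio_nil : word_ratio rho [::] = 1.
Proof. exact: big_nil. Qed.

Lemma word_ratio_cat u v :
  word_ratio rho (u ++ v) = word_ratio rho u * word_ratio rho v.
Proof. exact: big_cat. Qed.

Lemma word_ratio_rcons w i :
  word_ratio rho (rcons w i) = word_ratio rho w * rho i.
Proof. by rewrite -cats1 word_ratio_cat /word_ratio big_seq1. Qed.

Lemma word_ratio_gt0 w : 0 < word_ratio rho w.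
Proof. by apply: prodr_gt0 => i _; exact: ratio_gt0. Qed.

(** The default values keep [max_ratio] in [0, 1) and [min_ratio] positive even for an empty
    alphabet. *)
Definition max_ratio : R := \big[Num.max/0]_i rho i.
Definition min_ratio : R := \big[Num.min/1]_i rho i.

Lemma max_ratio_ge0 : 0 <= max_ratio.
Proof. exact: bigmax_ge_id. Qed.

Lemma max_ratio_lt1 : max_ratio < 1.
Proof. by apply/bigmax_ltP; split=> // i _; case/andP: (rho01 i). Qed.

Lemma le_max_ratio i : rho i <= max_ratio.
Proof. exact: le_bigmax. Qed.

Lemma min_ratio_gt0 : 0 < min_ratio.
Proof. by apply/bigmin_gtP; split=> // i _; exact: ratio_gt0. Qed.

Lemma min_ratio_le i : min_ratio <= rho i.
Proof. exact: bigmin_le. Qed.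

Lemma word_ratio_le_max w : word_ratio rho w <= max_ratio ^+ size w.
Proof.
elim: w => [|i w IH]; first by rewrite word_ratio_nil.
rewrite /word_ratio big_cons exprS; apply: ler_pM (le_max_ratio i) IH.
  exact/ltW/ratio_gt0.
exact/ltW/word_ratio_gt0.
Qed.

Lemma word_ratio_le1 w : word_ratio rho w <= 1.
Proof.
apply: le_trans (word_ratio_le_max w) _.
by rewrite exprn_ile1 ?max_ratio_ge0 ?ltW ?max_ratio_lt1.
Qed.

End WordRatios.

Lemma size_word_prefix N (c : code_space N) m : size (word_prefix c m) = m.
Proof. exact: size_mkseq. Qed.

Lemma word_prefixD N (c : code_space N) m k :
  word_prefix c (m + k) =
  word_prefix c m ++ word_prefix (fun i => c (m + i)%N) k.
Proof.
rewrite /word_prefix /mkseq iotaD map_cat add0n; congr (_ ++ _).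
by rewrite -[in LHS](addn0 m) iotaDl -map_comp.
Qed.

Section StoppingWords.
Variables (R : realType) (N : nat) (rho : 'I_N -> R).
Hypothesis rho01 : forall i, 0 < rho i < 1.
Implicit Types (u v w : seq 'I_N) (c : code_space N).

(** The words whose ratio drops to [r] or below exactly at their last letter: whatever their
    lengths, their images have comparable sizes. *)
Definition stopping_word (r : R) w :=
  word_ratio rho w <= r /\
  forall u, prefix u w -> u != w -> r < word_ratio rho u.

Lemma stopping_word_prefixfree r u v :
  stopping_word r u -> stopping_word r v -> u != v -> ~~ prefix u v.
Proof.
move=> [ru _] [_ rv] uv; apply/negP => /rv /(_ uv).
by rewrite ltNge ru.
Qed.

(** Without its last letter the word has ratio above [r], and one letter costs at most a factor
    [min_ratio rho]. The bound [r < 1] excludes the empty word. *)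
Lemma stopping_word_ge r w : 0 < r < 1 -> stopping_word r w ->
  min_ratio rho * r <= word_ratio rho w.
Proof.
move=> /andP[r0 r1]; case/lastP: w => [|w i] [rw hw].
  by move: rw; rewrite word_ratio_nil leNgt r1.
have := hw w (prefix_rcons _ _).
rewrite -[X in X != _]cats0 -cats1 eqseq_cat // eqxx => /(_ isT) rlt.
rewrite cats1 word_ratio_rcons mulrC.
exact: ler_pM (ltW r0) (ltW (min_ratio_gt0 rho01)) (ltW rlt) (min_ratio_le rho i).
Qed.

Lemma stopping_word_exists c r : 0 < r ->
  exists m, stopping_word r (word_prefix c m).
Proof.
move=> r0.
have ex : exists m, word_ratio rho (word_prefix c m) <= r.
  have : geometric 1 (max_ratio rho) m @[m --> \oo] --> (0 : R).
    by apply: cvg_geometric; rewrite ger0_norm ?max_ratio_ge0 ?(max_ratio_lt1 rho01).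
  move=> /cvgr_lt /(_ r r0) [m _ hm]; exists m.
  apply: le_trans ((word_ratio_le_max rho01) _) _; rewrite size_word_prefix.
  by have := hm m (leqnn m); rewrite /= mul1r => /ltW.
case: (ex_minnP ex) => m rm mmin; exists m; split => // u /prefixP[v e] uw.
have um : (size u <= m)%N.
  by rewrite -(size_word_prefix c m) e size_cat leq_addr.
have eu : u = word_prefix c (size u).
  move: e; rewrite -(subnKC um) word_prefixD => /eqP.
  by rewrite eqseq_cat ?size_word_prefix // => /andP[/eqP -> _].
rewrite ltNge; apply/negP; rewrite eu => /mmin mu.
by move: uw; rewrite eu (@anti_leq (size u) m) ?um ?mu // eqxx.
Qed.

End StoppingWords.

Section WordMaps.
Variables (R : realType) (n N : nat).
Variables (f : 'I_N -> 'rV[R]_n -> 'rV[R]_n) (rho : 'I_N -> R).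
Hypothesis hf : forall i, contracting_similarity (f i) (rho i).
Implicit Types (u v w : seq 'I_N) (c : code_space N).

Let rho01 i : 0 < rho i < 1 := (hf i).1.

Lemma word_map_cat u v x :
  word_map f (u ++ v) x = word_map f u (word_map f v x).
Proof. by elim: u => //= i u ->. Qed.

Lemma edist_word_map w x y :
  edist (word_map f w x) (word_map f w y) = word_ratio rho w * edist x y.
Proof.
elim: w => [|i w IH] /=; first by rewrite word_ratio_nil mul1r.
by rewrite (hf i).2 IH mulrA /word_ratio big_cons.
Qed.

Lemma edist_word_map_le w x y :
  edist (word_map f w x) (word_map f w y) <= edist x y.
Proof. by rewrite edist_word_map ler_piMl ?edist_ge0 ?(word_ratio_le1 rho01). Qed.

Lemma word_map_surj w y : exists x, word_map f w x = y.
Proof. exact: similarity_surj ((word_ratio_gt0 rho01) w) (edist_word_map w) y. Qed.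

Lemma word_orbit_bounded :
  exists2 D : R, 0 <= D & forall w, edist (word_map f w 0) 0 <= D.
Proof.
pose m : R := \big[Num.max/0]_i edist (f i 0) 0.
have m0 : 0 <= m by exact: bigmax_ge_id.
have M1 : 0 < 1 - max_ratio rho by rewrite subr_gt0 (max_ratio_lt1 rho01).
(* The solution of [D = max_ratio rho * D + m], so that prepending a letter preserves the bound. *)
exists (m / (1 - max_ratio rho)); first by rewrite divr_ge0 // ltW.
elim=> [|i w IH] /=; first by rewrite edistxx divr_ge0 // ltW.
apply: le_trans (edist_triangle (f i 0) _ _) _.
rewrite (hf i).2.
have -> : m / (1 - max_ratio rho) = max_ratio rho * (m / (1 - max_ratio rho)) + m.
  by field; rewrite gt_eqF.
apply: lerD; last exact: (le_bigmax _ (fun i => edist (f i 0) 0)).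
apply: ler_pM (le_max_ratio rho i) IH; last exact: edist_ge0.
exact/ltW/(ratio_gt0 rho01).
Qed.

Lemma edist_word_prefix (D : R) c m k :
  (forall w, edist (word_map f w 0) 0 <= D) -> (m <= k)%N ->
  edist (word_map f (word_prefix c m) 0) (word_map f (word_prefix c k) 0)
    <= word_ratio rho (word_prefix c m) * D.
Proof.
move=> hD /subnKC <-; rewrite word_prefixD word_map_cat edist_word_map edistC.
by rewrite ler_wpM2l // ltW // (word_ratio_gt0 rho01).
Qed.

Lemma coding_map_cvg c :
  word_map f (word_prefix c m) 0 @[m --> \oo] --> coding_map f c.
Proof.
have [D D0 hD] := word_orbit_bounded.
apply: cauchy_cvg; apply: cauchy_exP => e e0.
have [m _ hm] : \forall m \near \oo, D * max_ratio rho ^+ m < e.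
  have : geometric D (max_ratio rho) m @[m --> \oo] --> (0 : R).
    by apply: cvg_geometric; rewrite ger0_norm ?max_ratio_ge0 ?(max_ratio_lt1 rho01).
  by move=> /cvgr_lt /(_ e e0).
exists (word_map f (word_prefix c m) 0); exists m => // k /= mk.
apply: ball_edist => //; apply: le_lt_trans (edist_word_prefix c hD mk) _.
apply: le_lt_trans (hm m (leqnn m)); rewrite mulrC ler_wpM2l //.
by have := (word_ratio_le_max rho01) (word_prefix c m); rewrite size_word_prefix.
Qed.

Lemma edist_coding_map (D : R) c m :
  (forall w, edist (word_map f w 0) 0 <= D) ->
  edist (word_map f (word_prefix c m) 0) (coding_map f c)
    <= word_ratio rho (word_prefix c m) * D.
Proof.
move=> hD; apply/ler_addgt0Pr => e e0.
(* Convergence is in the sup norm; the Euclidean error is at most [n] times larger, hence below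
   [e]. *)
have e1 : 0 < e / n.+1%:R by rewrite divr_gt0.
have /cvg_ballP/(_ _ e1)[k _ hk] := @coding_map_cvg c.
pose j := maxn k m.
apply: le_trans (edist_triangle (word_map f (word_prefix c j) 0) _ _) _.
apply: lerD; first by apply: edist_word_prefix; rewrite ?leq_maxr.
rewrite edistC; apply: le_trans (edist_le_ball (hk j (leq_maxl _ _))) _.
by rewrite mulrCA ger_pMr // ler_pdivrMr // mul1r ler_nat.
Qed.

Section OpenSet.
Variable U : set 'rV[R]_n.
Hypothesis fU : \bigcup_i (f i @` U) `<=` U.
Hypothesis fU0 : forall i j, i != j -> (f i @` U) `&` (f j @` U) = set0.

Lemma word_map_sub w x : U x -> U (word_map f w x).
Proof.
by move=> Ux; elim: w => //= i w IH; apply: fU; exists i => //; exists (word_map f w x).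
Qed.

(** A common prefix is cancelled by injectivity; at the first differing letters the two points lie
    in disjoint images of [U]. *)
Lemma word_map_disjoint u v x y : ~~ prefix u v -> ~~ prefix v u ->
  U x -> U y -> word_map f u x <> word_map f v y.
Proof.
elim: u v => [|i u IH] [|j v] //=.
have [->|ij] := eqVneq i j; rewrite ?eqxx /=.
  move=> uv vu Ux Uy /(similarity_inj ((ratio_gt0 rho01) j) (hf j).2).
  exact: IH.
move=> _ _ Ux Uy e; have : set0 (f i (word_map f u x)).
  rewrite -(fU0 ij); split; first by exists (word_map f u x) => //; exact: word_map_sub.
  by rewrite e; exists (word_map f v y) => //; exact: word_map_sub.
by [].
Qed.

(** By surjectivity, a point closer than [word_ratio rho u * a] to [word_map f u x0] is the image
    under [word_map f u] of a point of the ball, hence of [U]. Disjointness forbids this for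
    [word_map f v x0]. *)
Lemma word_map_separated u v x0 a : 0 < a -> ball x0 a `<=` U ->
  ~~ prefix u v -> ~~ prefix v u ->
  word_ratio rho u * a <= edist (word_map f u x0) (word_map f v x0).
Proof.
move=> a0 aU uv vu; rewrite leNgt; apply/negP => h.
have [z uz] := word_map_surj u (word_map f v x0).
move: h; rewrite -uz edist_word_map ltr_pM2l ?(word_ratio_gt0 rho01) // => h.
have Uz : U z by apply: aU; exact: ball_edist.
by apply: (word_map_disjoint uv vu Uz _ uz); apply: aU; exact: ballxx.
Qed.

End OpenSet.

End WordMaps.

(** * Null sets and Hausdorff measure *)

Lemma ler_sum_uniq_sub (R : numDomainType) (I : eqType) (l l' : seq I) (F : I -> R) :
  uniq l -> {subset l <= l'} -> (forall i, 0 <= F i) ->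
  \sum_(i <- l) F i <= \sum_(i <- l') F i.
Proof.
elim: l l' => [|a l IH] l' /=; first by move=> _ _ F0; rewrite big_nil sumr_ge0.
move=> /andP[al ul] sl F0; rewrite big_cons [leRHS](big_rem a) /=; last first.
  by apply: sl; rewrite mem_head.
rewrite lerD2l; apply: IH => // i il.
have : i \in l' by apply: sl; rewrite inE il orbT.
rewrite (perm_mem (perm_to_rem (sl a (mem_head _ _)))) inE => /predU1P[ia|//].
by rewrite -ia il in al.
Qed.

Lemma sum_halves_le (R : realFieldType) (e : R) m :
  0 <= e -> \sum_(k < m) e / 2 ^+ k.+1 <= e.
Proof.
move=> e0; have -> : \sum_(k < m) e / 2 ^+ k.+1 = e - e / 2 ^+ m.
  elim: m => [|m IH]; first by rewrite big_ord0 divr1 subrr.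
  by rewrite big_ord_recr /= IH exprS; field; rewrite expf_neq0.
by rewrite gerBl divr_ge0 // exprn_ge0.
Qed.

Section SmallCovers.
Variables (R : realType) (n : nat).
Implicit Types (t e : R) (A B : set 'rV[R]_n).

(* A vanishing radius encodes an empty ball. *)
Definition small_cover (I : eqType) t e A (x : I -> 'rV[R]_n) (r : I -> R) :=
  [/\ forall i, 0 <= r i, forall y, A y -> exists i, edist (x i) y < r i
    & forall l, uniq l -> \sum_(i <- l) r i `^ t <= e].

(** No mesh is prescribed: for [t > 0] every single term is at most [e], so a small [e] forces small
    radii. *)
Definition hausdorff_null t A := forall e, 0 < e ->
  exists (x : nat -> 'rV[R]_n) (r : nat -> R), small_cover t e A x r.

(** Reindexing by [pickle]. Numbers that code no index get radius 0, which adds nothing to the sum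
    because [t > 0]. *)
Lemma small_cover_nat (I : countType) t e A (x : I -> 'rV[R]_n) r :
  0 < t -> small_cover t e A x r ->
  exists (x' : nat -> 'rV[R]_n) (r' : nat -> R), small_cover t e A x' r'.
Proof.
move=> t0 [r0 Ax re].
pose r' k := oapp r 0 (@pickle_inv I k).
exists (fun k => oapp x 0 (@pickle_inv I k)), r'; split.
- by move=> k; rewrite /r'; case: pickle_inv => /=.
- by move=> y /Ax[i xi]; exists (pickle i); rewrite /r' pickleK_inv.
- move=> l ul; suff -> : \sum_(k <- l) r' k `^ t =
      \sum_(i <- pmap (@pickle_inv I) l) r i `^ t.
    exact/re/(pmap_uniq (@pickle_invK I)).
  elim: l {ul} => [|k l IH]; first by rewrite !big_nil.
  rewrite big_cons IH /= /r'; case: pickle_inv => [i|] /=.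
    by rewrite big_cons.
  by rewrite powR0 ?gt_eqF // add0r.
Qed.

Lemma hausdorff_null_sub t A B : A `<=` B -> hausdorff_null t B ->
  hausdorff_null t A.
Proof.
move=> AB nB e /nB[x [r [r0 Bx re]]]; exists x, r; split => // y /AB; exact: Bx.
Qed.

Lemma small_cover_radius t e A (I : eqType) (x : I -> 'rV[R]_n) r d i :
  0 < t -> 0 <= d -> e <= d `^ t -> small_cover t e A x r -> r i <= d.
Proof.
move=> t0 d0 ed [r0 _ re]; have := re [:: i] isT.
rewrite big_seq1 => /le_trans /(_ ed); rewrite !leNgt; apply: contra => di.
by apply: gt0_ltr_powR => //; rewrite nnegrE.
Qed.

Lemma hausdorff_null_le t t' A : 0 < t <= t' -> hausdorff_null t A ->
  hausdorff_null t' A.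
Proof.
move=> /andP[t0 tt'] nA e e0.
(* Capping [e] at 1 keeps the radii at most 1, where raising the exponent decreases the powers. *)
have /nA[x [r Ar]] : 0 < Num.min e 1 by rewrite lt_min e0 ltr01.
have r1 i : r i <= 1.
  by apply: small_cover_radius Ar => //; rewrite powR1 ge_min lexx orbT.
have [r0 Ax re] := Ar; exists x, r; split => // l /re.
rewrite le_min => /andP[+ _]; apply: le_trans; apply: ler_sum => i _.
have [->|ri] := eqVneq (r i) 0.
  by rewrite !powR0 // gt_eqF // (lt_le_trans t0).
by apply: ger_powR => //; rewrite lt_neqAle eq_sym ri r0 r1.
Qed.

Lemma hausdorff_null_bigcup t (A : nat -> set 'rV[R]_n) : 0 < t ->
  (forall k, hausdorff_null t (A k)) -> hausdorff_null t (\bigcup_k A k).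
Proof.
move=> t0 nA e e0.
have ek k : 0 < e / 2 ^+ k.+1 by rewrite divr_gt0 ?exprn_gt0.
have /choice[x /choice[r hr]] : forall k, exists x, exists r : nat -> R,
    small_cover t (e / 2 ^+ k.+1) (A k) x r by move=> k; exact: nA.
apply: (@small_cover_nat (nat * nat)%type _ _ _
  (fun p => x p.1 p.2) (fun p => r p.1 p.2)) => //; split.
- by move=> [k j] /=; case: (hr k).
- by move=> y [k _ /(let: And3 _ h _ := hr k in h y)[j xj]]; exists (k, j).
(* A finite list of pairs involves only the covers with index below [K]; its sum is split by
   cover. *)
- move=> l ul; pose K := \max_(p <- l) p.1.+1.
  have lK p : p \in l -> (p.1 < K)%N.
    by move=> pl; rewrite /K (big_rem p) //= leq_max leqnn.
  rewrite (eq_big_seq (fun p : nat * nat =>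
    \sum_(k < K) if p.1 == k :> nat then r k p.2 `^ t else 0)); last first.
    move=> p pl; rewrite (bigD1 (Ordinal (lK _ pl))) //= eqxx big1 ?addr0 // => k kp.
    by case: eqP => // pk; case/eqP: kp; apply: val_inj.
  rewrite exchange_big /=.
  apply: (@le_trans _ _ (\sum_(k < K) e / 2 ^+ k.+1)).
    apply: ler_sum => k _; rewrite -big_mkcond /=.
    have [_ _ /(_ [seq p.2 | p <- l & p.1 == k :> nat])] := hr k.
    rewrite big_map big_filter; apply.
    rewrite map_inj_in_uniq ?filter_uniq // => -[a b] [c d].
    by rewrite !mem_filter /= => /andP[/eqP -> _] /andP[/eqP -> _] ->.
  exact/sum_halves_le/ltW.
Qed.

Lemma hausdorff_null_image t A (g : 'rV[R]_n -> 'rV[R]_n) :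
  (forall x y, edist (g x) (g y) <= edist x y) ->
  hausdorff_null t A -> hausdorff_null t (g @` A).
Proof.
move=> g1 nA e /nA[x [r [r0 Ax re]]]; exists (g \o x), r; split => // _ [y Ay <-].
by have [i xi] := Ax y Ay; exists i; exact: le_lt_trans (g1 _ _) xi.
Qed.

Lemma hausdorff_nullU t A B : 0 < t -> hausdorff_null t A ->
  hausdorff_null t B -> hausdorff_null t (A `|` B).
Proof.
move=> t0 nA nB.
rewrite -bigcup2E; apply: hausdorff_null_bigcup => // -[|[|k]] //=.
by apply: hausdorff_null_sub nA.
Qed.

End SmallCovers.

Section HausdorffMeasure.
Variables (R : realType) (n : nat).
Implicit Types (t e : R) (A B : set 'rV[R]_n).

Lemma diam_pow_ge0 t A : (0 <= diam_pow t A)%E.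
Proof. by rewrite /diam_pow; case: ifP => // _; exact: poweR_ge0. Qed.

Lemma diam_ge_edist A x y : A x -> A y -> ((edist x y)%:E <= diam A)%E.
Proof. by move=> Ax Ay; apply: ereal_sup_ubound; exists x => //; exists y. Qed.

Lemma diam_le A e : (forall x y, A x -> A y -> edist x y <= e) ->
  (diam A <= e%:E)%E.
Proof.
by move=> h; apply: ge_ereal_sup => _ [x Ax [y Ay <-]]; rewrite lee_fin h.
Qed.

Lemma diam_pow_le t A e : 0 < t -> 0 <= e ->
  (forall x y, A x -> A y -> edist x y <= e) ->
  (diam_pow t A <= (e `^ t)%:E)%E.
Proof.
move=> t0 e0 h; rewrite /diam_pow; have [_|/set0P[x Ax]] := eqVneq A set0.
  by rewrite lee_fin powR_ge0.
have := diam_le h; have := diam_ge_edist Ax Ax; rewrite edistxx.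
case: (diam A) => [d| |] //=; rewrite !lee_fin => d0 de.
by rewrite ge0_ler_powR // ?nnegrE // ltW.
Qed.

Lemma hausdorff_premeasure_ge0 t d A : (0 <= hausdorff_premeasure t d A)%E.
Proof.
apply: le_ereal_inf_tmp => _ [U _ <-].
by apply: nneseries_ge0 => i _ _; exact: diam_pow_ge0.
Qed.

Lemma hausdorff_measure0_cover t A e : hausdorff_measure t A = 0%E -> 0 < e ->
  exists2 U, delta_cover 1 A U & (\sum_(0 <= i <oo) diam_pow t (U i) < e%:E)%E.
Proof.
move=> H0 e0.
have : (hausdorff_premeasure t 1 A < e%:E)%E.
  apply: (@le_lt_trans _ _ 0%E); last by rewrite lte_fin.
  by rewrite -H0; apply: ereal_sup_ubound; exists 1 => //=.
by move=> /ereal_inf_lt[_ [U AU <-] h]; exists U.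
Qed.

(** For exponent 0 every non-empty member of a cover contributes 1, so a cover with sum below 1 has
    only empty members. *)
Lemma hausdorff_measure00 A : hausdorff_measure 0 A = 0%E -> A = set0.
Proof.
move=> /hausdorff_measure0_cover /(_ ltr01)[U [AU _]].
apply: contraPP => /eqP/set0P[y /AU[i _ Ui]]; apply/negP; rewrite -leNgt.
apply: le_trans (nneseries_lim_ge i.+1 _); last first.
  by move=> *; exact: diam_pow_ge0.
rewrite big_nat_recr //=; apply: (@le_trans _ _ (diam_pow 0 (U i))).
  rewrite /diam_pow ifF ?poweRe0 //; apply/negbTE/set0P; by exists y.
by rewrite leeDr // sume_ge0 // => *; exact: diam_pow_ge0.
Qed.

(* A set of diameter [d] lies in an open ball of radius [2 * max d e] for every
   [e > 0]; the choice of [e] keeps the [t]-th powers summable when [d = 0]. *)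
Lemma hausdorff_measure0_null t A : 0 < t -> hausdorff_measure t A = 0%E ->
  hausdorff_null t A.
Proof.
move=> t0 H0 eps eps0.
pose eta := eps / 2 / 2 `^ t.
have eta0 : 0 < eta by rewrite !divr_gt0 // powR_gt0.
have [U [AU Ud] hU] := hausdorff_measure0_cover H0 eta0.
pose d i := fine (diam (U i)).
pose e i := (eta / 2 ^+ i.+1) `^ t^-1.
have e0 i : 0 < e i by rewrite powR_gt0 // divr_gt0 // exprn_gt0.
have et i : e i `^ t = eta / 2 ^+ i.+1.
  by rewrite /e -powRrM mulVf ?gt_eqF // powRr1 // divr_ge0 ?exprn_ge0 // ltW.
(* A non-empty [U i] has diameter between 0 and 1, so [fine] loses nothing; on an empty one the
   diameter is [-oo]. *)
have Udiam i y : U i y -> 0 <= d i /\ diam (U i) = (d i)%:E.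
  move=> Uy; have := Ud i; have := diam_ge_edist Uy Uy; rewrite edistxx /d.
  by case: (diam (U i)).
pose p i := fine (diam_pow t (U i)).
have pE i : diam_pow t (U i) = (p i)%:E.
  rewrite /p /diam_pow; case: eqVneq => // /set0P[y Uy].
  by have [_ ->] := Udiam i y Uy.
have p0 i : 0 <= p i by rewrite fine_ge0 // diam_pow_ge0.
exists (fun i => get (U i)),
  (fun i => if U i == set0 then 0 else 2 * Num.max (d i) (e i)); split.
- move=> i; case: ifP => // _; rewrite mulr_ge0 // le_max.
  by rewrite (ltW (e0 i)) orbT.
- move=> y /AU[i _ Uy]; exists i; have /negPf -> : U i != set0.
    by apply/set0P; exists y.
  have [d0 dE] := Udiam i y Uy.
  have : edist (get (U i)) y <= d i.
    by rewrite -lee_fin -dE; apply: diam_ge_edist => //; exact: getI Uy.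
  move=> /le_lt_trans; apply; rewrite mulr_natl mulr2n.
  by have := e0 i; case: (leP (d i) (e i)) => *; lra.
- move=> l ul.
  pose K := \max_(i <- l) i.+1.
  have lK : {subset l <= index_iota 0 K}.
    by move=> i il; rewrite mem_index_iota /= /K (big_rem i) //= leq_max leqnn.
  pose F i := 2 `^ t * (p i + eta / 2 ^+ i.+1).
  have F0 i : 0 <= F i.
    by rewrite mulr_ge0 ?powR_ge0 // addr_ge0 // divr_ge0 ?exprn_ge0 // ltW.
  apply: (@le_trans _ _ (\sum_(i <- l) F i)).
    apply: ler_sum => i _; case: eqVneq => [|/set0P[y Uy]].
      by rewrite powR0 ?gt_eqF.
    have [d0 dE] := Udiam i y Uy.
    have pd : p i = d i `^ t.
      rewrite /p /diam_pow dE /= ifF //; apply/negbTE/set0P; by exists y.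
    rewrite /F pd -et powRM // ?ler_wpM2l ?powR_ge0 ?le_max ?d0 //.
    have := powR_ge0 (d i) t; have := powR_ge0 (e i) t.
    by case: (leP (d i) (e i)) => *; lra.
  apply: le_trans (ler_sum_uniq_sub ul lK F0) _.
  rewrite -mulr_sumr big_split /= -ler_pdivlMl ?powR_gt0 //.
  have -> : (2 `^ t)^-1 * eps = eta + eta.
    by rewrite /eta; field; rewrite gt_eqF // powR_gt0.
  apply: lerD; last by rewrite big_mkord; exact/sum_halves_le/ltW.
  rewrite -lee_fin -sumEFin; apply: le_trans (ltW hU).
  under eq_bigr do rewrite -pE.
  by apply: nneseries_lim_ge => *; exact: diam_pow_ge0.
Qed.

Lemma hausdorff_null_measure0 t A : 0 < t -> hausdorff_null t A ->
  hausdorff_measure t A = 0%E.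
Proof.
move=> t0 nA; apply/eqP; rewrite eq_le; apply/andP; split; last first.
  apply: le_ereal_sup_tmp; exists (hausdorff_premeasure t 1 A).
    by exists 1 => //=.
  exact: hausdorff_premeasure_ge0.
apply: ge_ereal_sup => _ [d /= d0 <-]; apply/lee_addgt0Pr => e e0.
rewrite add0e.
pose eta := Num.min (e / 2 `^ t) ((d / 2) `^ t).
have /nA[x [r xr]] : 0 < eta by rewrite lt_min !(divr_gt0, powR_gt0).
have rd i : r i <= d / 2.
  by apply: small_cover_radius xr => //; rewrite ?divr_ge0 ?(ltW d0) // ge_min lexx orbT.
have [r0 Ax re] := xr.
pose U i : set 'rV[R]_n := [set y | edist (x i) y < r i].
have Ur i y z : U i y -> U i z -> edist y z <= 2 * r i.
  rewrite /U /= => xy xz; apply: le_trans (edist_triangle (x i) _ _) _.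
  by rewrite (edistC y); lra.
apply: ge_ereal_inf; exists (\sum_(0 <= i <oo) diam_pow t (U i))%E.
  exists U => //; split; first by move=> y /Ax[i xi]; exists i.
  move=> i; apply: diam_le => y z yU zU.
  by apply: le_trans (Ur _ _ _ yU zU) _; have := rd i; lra.
apply: lime_le.
  by apply: is_cvg_nneseries => *; exact: diam_pow_ge0.
near=> K.
apply: (@le_trans _ _ (\sum_(0 <= i < K) ((2 * r i) `^ t)%:E)%E).
  apply: lee_sum => i _; apply: diam_pow_le => //; last exact: Ur.
  by rewrite mulr_ge0.
rewrite sumEFin lee_fin.
under eq_bigr do rewrite powRM //.
rewrite -mulr_sumr -ler_pdivlMl ?powR_gt0 //.
apply: le_trans (re _ (iota_uniq _ _)) _.
by rewrite ge_min mulrC lexx.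
Unshelve. all: by end_near.
Qed.

End HausdorffMeasure.

Section HausdorffDimension.
Variables (R : realType) (n : nat).
Implicit Types (t e : R) (A B : set 'rV[R]_n).



Lemma hausdorff_dim_le t A : 0 < t -> hausdorff_null t A ->
  (hausdorff_dim A <= t%:E)%E.
Proof.
move=> t0 nA; apply: ereal_inf_lbound; exists t => //; split; first exact: ltW.
exact: hausdorff_null_measure0.
Qed.

Lemma hausdorff_dim_lt_null t A : (hausdorff_dim A < t%:E)%E ->
  hausdorff_null t A.
Proof.
move=> /ereal_inf_lt[_ [u [u0 Hu] <-]]; rewrite lte_fin => ut.
have [u00|u_neq0] := eqVneq u 0.
  (* A null set for exponent 0 is empty, and zero radii cover it. *)
  move: Hu ut; rewrite u00 => /hausdorff_measure00 -> t0 e e0.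
  exists (fun=> 0), (fun=> 0); split => // l _.
  by rewrite big1 ?ltW // => i _; rewrite powR0 // gt_eqF.
have u_gt0 : 0 < u by rewrite lt_neqAle eq_sym u_neq0.
apply: (@hausdorff_null_le _ _ u); first by rewrite u_gt0 ltW.
exact: hausdorff_measure0_null.
Qed.

(** Non-emptiness rules out exponent 0, so only positive exponents, for which covers by balls
    suffice, remain to be tested. *)
Lemma hausdorff_dim_ge A (z : \bar R) : A !=set0 ->
  (forall t, 0 < t -> hausdorff_null t A -> (z <= t%:E)%E) ->
  (z <= hausdorff_dim A)%E.
Proof.
move=> [y Ay] h; apply: le_ereal_inf_tmp => _ [t [t0 Ht] <-].
have [t00|t_neq0] := eqVneq t 0.
  by move: Ht; rewrite t00 => /hausdorff_measure00 A0; rewrite A0 in Ay.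
have t_gt0 : 0 < t by rewrite lt_neqAle eq_sym t_neq0.
exact/h/hausdorff_measure0_null.
Qed.

End HausdorffDimension.

(** * Sums over words *)

Section Codes.
Variables (N : nat) (S : set (code_space N)).

Lemma near_word_prefix (c : code_space N) m :
  \forall d \near c, word_prefix d m = word_prefix c m.
Proof.
have : \forall d \near c, forall i, (i < m)%N -> d i = c i.
  elim: m => [|m IH]; first by apply: filterE => d i.
  have cm : \forall d \near c, d m = c m.
    exact: (@proj_continuous nat (fun=> discrete_topology 'I_N) m c
      [set c m] (@discrete_set1 (discrete_topology 'I_N) _)).
  apply: filterS2 IH cm => d dc dm i.
  by rewrite ltnS leq_eqVlt => /predU1P[->//|]; exact: dc.
apply: filterS => d dc; apply/eq_in_map => i.
by rewrite mem_iota => /andP[_]; exact: dc.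
Qed.

(** The cylinders of words in [W] are open and cover [S]. Compactness is applied along [k] tending
    to infinity, with the words of [pickle] code below [k] as the finite families. *)
Lemma finite_code (W : set (seq 'I_N)) : compact S ->
  (forall c, S c -> exists m, W (word_prefix c m)) ->
  exists A : seq (seq 'I_N), [/\ uniq A, forall a, a \in A -> W a &
    forall c, S c -> exists2 a, a \in A & word_prefix c (size a) = a].
Proof.
move=> /compact_near_coveringP cS SW.
pose P k (c : code_space N) := exists a,
  [/\ W a, (pickle a < k)%N & word_prefix c (size a) = a].
have [k _ hk] : \forall k \near \oo, S `<=` P k.
  refine (cS nat \oo P _ _) => c /SW[m Wm].
  exists ([set d | word_prefix d m = word_prefix c m],
          [set k | (pickle (word_prefix c m) < k)%N]).
    by split; [exact: near_word_prefix|exists (pickle (word_prefix c m)).+1].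
  move=> [d k] [/= dc ck]; exists (word_prefix c m).
  by rewrite size_word_prefix.
exists [seq a <- pmap (@pickle_inv (seq 'I_N)) (iota 0 k) | `[< W a >]]; split.
- by apply: filter_uniq; apply: pmap_uniq (@pickle_invK _) _ (iota_uniq _ _).
- by move=> a; rewrite mem_filter => /andP[/asboolP].
- move=> c Sc; have [a [Wa ak ca]] := hk k (leqnn k) c Sc.
  exists a => //; rewrite mem_filter; apply/andP; split; first exact/asboolP.
  by rewrite mem_pmap; apply/mapP; exists (pickle a); rewrite ?mem_iota ?pickleK_inv.
Qed.

Lemma shift_closed_iter : shift_closed S -> forall c m, S c -> S (fun i => c (m + i)%N).
Proof.
move=> Sshift c m Sc; elim: m => [|m IH]; first exact: Sc.
have -> : (fun i => c (m.+1 + i)%N) = Defs.shift (fun i => c (m + i)%N).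
  by apply/funext => i; rewrite /Defs.shift addSnnS.
exact: Sshift.
Qed.

End Codes.

Section WordSums.
Variables (R : realType) (N : nat) (rho : 'I_N -> R) (S : set (code_space N)).
Hypothesis rho01 : forall i, 0 < rho i < 1.

Definition word_sum (t : R) (k : nat) : R :=
  \sum_(w \in words S k) word_ratio rho w `^ t.

Lemma word_sumE t k :
  word_sum t k = \sum_(w <- finmap.enum_fset (fset_set (words S k))) word_ratio rho w `^ t.
Proof. by rewrite /word_sum fsbig_finite //; exact: finite_words. Qed.

Lemma mem_words k w : w \in finmap.enum_fset (fset_set (words S k)) -> words S k w.
Proof. by rewrite in_fset_set ?inE //; exact: finite_words. Qed.

Lemma word_sum_ge0 t k : 0 <= word_sum t k.
Proof. by rewrite word_sumE sumr_ge0 // => w _; exact: powR_ge0. Qed.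

Lemma tau_seq_pow t k : (0 < k)%N -> tau_seq rho S t k ^+ k = word_sum t k.
Proof.
move=> k0; rewrite -powR_mulrn ?powR_ge0 // -powRrM mulVf ?pnatr_eq0 -?lt0n //.
exact/powRr1/word_sum_ge0.
Qed.



Lemma word_sum_decay t t' k : t <= t' ->
  word_sum t' k <= (max_ratio rho `^ (t' - t)) ^+ k * word_sum t k.
Proof.
move=> tt'; rewrite !word_sumE mulr_sumr big_seq [leRHS]big_seq.
apply: ler_sum => _ /mem_words[c _ <-].
set w := word_prefix c k; have w0 := word_ratio_gt0 rho01 w.
have -> : word_ratio rho w `^ t' = word_ratio rho w `^ (t' - t) * word_ratio rho w `^ t.
  by rewrite -powRD ?subrK // (gt_eqF w0) implybT.
rewrite ler_wpM2r ?powR_ge0 // -powR_mulrn ?powR_ge0 // -powRrM mulrC powRrM.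
have m0 : 0 <= max_ratio rho by exact: bigmax_ge_id.
rewrite powR_mulrn // ge0_ler_powR ?subr_ge0 ?nnegrE ?exprn_ge0 //.
  exact: ltW.
have := word_ratio_le_max rho01 w; rewrite size_word_prefix; exact.
Qed.

(* Splitting off the first factor in [A] bounds the sum at length [k] by those at
   smaller lengths. *)
Lemma word_sum_bounded t (A : seq (seq 'I_N)) : shift_closed S ->
  (forall a, a \in A -> (0 < size a)%N) ->
  (forall c, S c -> exists2 a, a \in A & word_prefix c (size a) = a) ->
  \sum_(a <- A) word_ratio rho a `^ t <= 1 ->
  exists M, forall k, word_sum t k <= M.
Proof.
move=> Sshift A0 SA A1; pose L := \max_(a <- A) size a.
have AL a : a \in A -> (size a <= L)%N.
  by move=> aA; rewrite /L (big_rem a) //= leq_maxl.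
(* [M] dominates the sums at lengths below [L] outright; longer words have room for a factor in
   [A]. *)
pose M := \sum_(j < L) word_sum t j.
have M0 : 0 <= M by apply: sumr_ge0 => j _; exact: word_sum_ge0.
exists M; elim/ltn_ind => k IH; have [kL|Lk] := ltnP k L.
  rewrite /M (bigD1 (Ordinal kL)) //= lerDl.
  by apply: sumr_ge0 => j _; exact: word_sum_ge0.
rewrite word_sumE.
(* Every word of [S] of length [k] occurs in [l]: its tail after the factor [a] is a prefix of an
   iterated shift. Any further entries of [l] only enlarge the sum. *)
pose l := [seq a ++ v | a <- A, v <- finmap.enum_fset (fset_set (words S (k - size a)))].
apply: (@le_trans _ _ (\sum_(w <- l) word_ratio rho w `^ t)).
  apply: ler_sum_uniq_sub => [||w]; [exact: finmap.fset_uniq| |exact: powR_ge0].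
  move=> _ /mem_words[c Sc <-]; have [a aA ca] := SA c Sc.
  apply/allpairsPdep; exists a, (word_prefix (fun i => c (size a + i)%N) (k - size a)).
  split => //; last first.
    by rewrite -[X in X ++ _]ca -word_prefixD subnKC // (leq_trans (AL a aA)).
  rewrite in_fset_set ?inE; last exact: finite_words.
  exists (fun i => c (size a + i)%N) => //.
  exact: (@shift_closed_iter _ _ Sshift c (size a) Sc).
rewrite big_allpairs_dep /=.
apply: (@le_trans _ _ (\sum_(a <- A) word_ratio rho a `^ t * M)); last first.
  by rewrite -mulr_suml ler_piMl.
rewrite big_seq [leRHS]big_seq; apply: ler_sum => a aA.
under eq_bigr do rewrite word_ratio_cat powRM ?ltW ?word_ratio_gt0 //.
rewrite -mulr_sumr ler_wpM2l ?powR_ge0 // -word_sumE IH //.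
by rewrite ltn_subrL A0 // (leq_trans (A0 a aA)) // (leq_trans (AL a aA)).
Qed.

End WordSums.

(** * Limit sets *)

Lemma powR_lt1 (R : realType) (x t : R) : 0 <= x < 1 -> 0 < t -> x `^ t < 1.
Proof.
move=> /andP[x0 x1] t0; have <- : 1 `^ t = 1 :> R by rewrite powR1.
by apply: gt0_ltr_powR; rewrite ?nnegrE.
Qed.

Section Tau.
Variables (R : realType) (N : nat) (rho : 'I_N -> R) (S : set (code_space N)).
Hypothesis rho01 : forall i, 0 < rho i < 1.

Lemma powR_max_ratio_lt1 t : 0 < t -> max_ratio rho `^ t < 1.
Proof.
by move=> t0; rewrite powR_lt1 // max_ratio_ge0 max_ratio_lt1.
Qed.

Let geometric_small (M q e : R) : 0 <= q < 1 -> 0 < e ->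
  \forall k \near \oo, M * q ^+ k < e.
Proof.
move=> /andP[q0 q1] e0.
have : geometric M q k @[k --> \oo] --> (0 : R).
  by apply: cvg_geometric; rewrite ger0_norm.
by move=> /cvgr_lt /(_ e e0).
Qed.

(** If [t < s], the sums at [s] are at most [M * lam ^+ k], yet they eventually exceed [q ^+ k] for
    [q] midway between [lam] and 1. *)
Lemma tau_le_of_word_sum_bounded s t M :
  tau_seq rho S s k @[k --> \oo] --> (1 : R) ->
  (forall k, word_sum rho S t k <= M) -> s <= t.
Proof.
move=> tau1 tM; rewrite leNgt; apply/negP => ts.
pose lam := max_ratio rho `^ (s - t).
have lam1 : lam < 1 by rewrite powR_max_ratio_lt1 ?subr_gt0.
have lam0 : 0 <= lam by exact: powR_ge0.
pose q := (1 + lam) / 2.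
have q0 : 0 < q by rewrite /q; lra.
have q1 : q < 1 by rewrite /q; lra.
have lq : 0 <= lam / q < 1.
  by rewrite divr_ge0 ?(ltW q0) //= ltr_pdivrMr // mul1r /q; lra.
have [k1 _ h1] := cvgr_gt _ tau1 _ q1.
have [k2 _ h2] := geometric_small M lq ltr01.
pose k := maxn k1 (maxn k2 1).
have k10 : (k1 <= k)%N by rewrite leq_maxl.
have k20 : (k2 <= k)%N by rewrite /k; lia.
have k0 : (0 < k)%N by rewrite /k; lia.
have := h2 k k20; apply/negP; rewrite -leNgt.
rewrite /= expr_div_n mulrA ler_pdivlMr ?exprn_gt0 // mul1r.
apply: (@le_trans _ _ (word_sum rho S s k)).
  by rewrite -tau_seq_pow // lerXn2r ?nnegrE ?powR_ge0 ?ltW //; exact: h1.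
apply: le_trans (word_sum_decay S rho01 k (ltW ts)) _.
by rewrite mulrC ler_wpM2r ?exprn_ge0.
Qed.

Lemma word_sum_small s t e : tau_seq rho S s k @[k --> \oo] --> (1 : R) ->
  s < t -> 0 < e -> exists k, word_sum rho S t k < e.
Proof.
move=> tau1 st e0.
pose lam := max_ratio rho `^ (t - s).
have lam1 : lam < 1 by rewrite powR_max_ratio_lt1 ?subr_gt0.
have lam0 : 0 <= lam by exact: powR_ge0.
(* Chosen so that [lam * q < 1 < q]: the sums at [s] are eventually below [q ^+ k], and those at [t]
   below [(lam * q) ^+ k]. *)
pose q := 2 / (1 + lam).
have q1 : 1 < q by rewrite /q ltr_pdivlMr; lra.
have q0 : 0 < q by lra.
have lq : 0 <= lam * q < 1.
  by rewrite mulr_ge0 ?(ltW q0) //= /q mulrA ltr_pdivrMr; lra.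
have [k1 _ h1] := cvgr_lt _ tau1 _ q1.
have [k2 _ h2] := geometric_small 1 lq e0.
pose k := maxn k1 (maxn k2 1).
have k10 : (k1 <= k)%N by rewrite leq_maxl.
have k20 : (k2 <= k)%N by rewrite /k; lia.
have k0 : (0 < k)%N by rewrite /k; lia.
exists k; apply: le_lt_trans (h2 k k20).
apply: le_trans (word_sum_decay S rho01 k (ltW st)) _.
rewrite /= mul1r exprMn ler_wpM2l ?exprn_ge0 //.
by rewrite -tau_seq_pow // lerXn2r ?nnegrE ?powR_ge0 ?ltW //; exact: h1.
Qed.

End Tau.

Section LimitSet.
Variables (R : realType) (n N : nat).
Variables (f : 'I_N -> 'rV[R]_n -> 'rV[R]_n) (rho : 'I_N -> R).
Hypothesis hf : forall i, contracting_similarity (f i) (rho i).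
Variable S : set (code_space N).

Let rho01 i : 0 < rho i < 1 := (hf i).1.

(** The balls about [word_map f w 0] of radius [word_ratio rho w * (D + 1)], for [w] in [words S k],
    cover the set. [D + 1] in place of [D] makes the balls open and the radii positive. *)
Lemma coding_map_null s t : 0 <= s < t ->
  tau_seq rho S s k @[k --> \oo] --> (1 : R) ->
  hausdorff_null t (coding_map f @` S).
Proof.
move=> /andP[s0 st] tau1 e e0; have t0 : 0 < t by exact: le_lt_trans st.
have [D D0 hD] := word_orbit_bounded hf.
have D1 : 0 < D + 1 by lra.
have e1 : 0 < e / (D + 1) `^ t by rewrite divr_gt0 // powR_gt0.
have [k hk] := word_sum_small rho01 tau1 st e1.
pose r w := if w \in finmap.enum_fset (fset_set (words S k))
  then word_ratio rho w * (D + 1) else 0.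
apply: (@small_cover_nat _ _ _ _ _ _ (fun w => word_map f w 0) r) => //; split.
- move=> w; rewrite /r; case: ifP => // _.
  by rewrite mulr_ge0 ?(ltW D1) // ltW // word_ratio_gt0.
- move=> _ [c Sc <-]; exists (word_prefix c k).
  rewrite /r ifT; last first.
    by rewrite in_fset_set ?inE; [exists c|exact: finite_words].
  apply: le_lt_trans (edist_coding_map hf c k hD) _.
  by rewrite ltr_pM2l ?(word_ratio_gt0 rho01) // ltrDl.
- move=> l ul; apply: (@le_trans _ _ ((D + 1) `^ t * word_sum rho S t k)).
    rewrite word_sumE mulr_sumr.
    apply: (@le_trans _ _
      (\sum_(w <- [seq w <- l | w \in finmap.enum_fset (fset_set (words S k))])
        (D + 1) `^ t * word_ratio rho w `^ t)).
      rewrite big_filter [leRHS]big_mkcond; apply: ler_sum => w _.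
      rewrite /r; case: ifP => _; last by rewrite powR0 ?gt_eqF.
      by rewrite powRM ?(ltW D1) 1?mulrC // ltW // word_ratio_gt0.
    apply: ler_sum_uniq_sub => [|w|w]; first exact: filter_uniq.
      by rewrite mem_filter => /andP[].
    by rewrite mulr_ge0 ?powR_ge0.
  by rewrite mulrC -ler_pdivlMr ?powR_gt0 // ltW.
Qed.

(* Stopping words of scale [r i] met by the [i]-th ball of a fine cover send
   [x0] to separated points near its centre, so there are boundedly many. *)
Lemma coding_map_null_word_sum_bounded (U : set 'rV[R]_n) t :
  U !=set0 -> open U -> \bigcup_i (f i @` U) `<=` U ->
  (forall i j, i != j -> (f i @` U) `&` (f j @` U) = set0) ->
  compact S -> shift_closed S ->
  0 < t -> hausdorff_null t (coding_map f @` S) ->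
  exists M, forall k, word_sum rho S t k <= M.
Proof.
move=> [x0 Ux0] oU fU fU0 cS sS t0 nE.
have [D D0 hD] := word_orbit_bounded hf.
have /nbhs_ballP[a /= a0 aU] : nbhs x0 U by exact: open_nbhs_nbhs.
have da0 : 0 < min_ratio rho * a by rewrite mulr_gt0 // min_ratio_gt0.
have [c hc] := @separated_points_bound R n (edist x0 0 + D + 1) _ da0.
(* [c * e <= 1] bounds the final sum, and [e < 1] even for [c = 0], so all radii are below 1 and no
   stopping word is empty. *)
pose e : R := c.+2%:R^-1.
have e0 : 0 < e by rewrite invr_gt0.
have e1 : e < 1 by rewrite invf_lt1 // ltr1n.
have [x [r xr]] := nE e e0.
have r1 i : r i < 1.
  apply: (@le_lt_trans _ _ (e `^ t^-1)).
    apply: small_cover_radius xr => //; first exact: powR_ge0.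
    by rewrite -powRrM mulVf ?gt_eqF // powRr1 // ltW.
  by apply: powR_lt1; rewrite ?invr_gt0 // e1 ltW.
have [r0 Ex re] := xr.
(* The stopping words of scale [r i] that begin a code whose point lies in ball [i]. *)
pose V i w := exists2 d, edist (x i) (coding_map f d) < r i &
  stopping_word rho (r i) w /\ w = word_prefix d (size w).
have rV i w : V i w -> 0 < r i.
  by move=> [d xd _]; apply: le_lt_trans xd; exact: edist_ge0.
have [d Sd|A [uA AV SA]] := @finite_code _ S (fun w => exists i, V i w) cS.
  have [i xd] : exists i, edist (x i) (coding_map f d) < r i.
    by apply: Ex; exists d.
  have ri : 0 < r i by apply: le_lt_trans xd; exact: edist_ge0.
  have [m hm] := stopping_word_exists rho01 d ri.
  by exists m, i, d => //; rewrite size_word_prefix.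
apply: (word_sum_bounded rho01 (A := A)) => //.
  move=> [|i w] // /AV[i [d _ [[]]]].
  by rewrite word_ratio_nil leNgt r1.
have /choice[g hg] : forall w, exists i, w \in A -> V i w.
  move=> w; case: (boolP (w \in A)) => [/AV[i Vi]|_]; last by exists 0%N.
  by exists i.
apply: (@le_trans _ _ (\sum_(w <- A) r (g w) `^ t)).
  rewrite big_seq [leRHS]big_seq; apply: ler_sum => w /hg[d _ [[rw _] _]].
  by apply: ge0_ler_powR; rewrite ?nnegrE ?(ltW t0) ?r0 // ltW // word_ratio_gt0.
pose l := undup [seq g w | w <- A].
have -> : \sum_(w <- A) r (g w) `^ t =
    \sum_(w <- A) \sum_(i <- l) if i == g w then r i `^ t else 0.
  apply: eq_big_seq => w wA.
  rewrite (bigD1_seq (g w)) ?undup_uniq ?mem_undup ?map_f //= eqxx.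
  by rewrite big1 ?addr0 // => i /negPf ->.
(* Grouped by balls: each [i] in [l] is chosen by at most [c] words of [A]. *)
rewrite exchange_big /=.
apply: (@le_trans _ _ (\sum_(i <- l) c%:R * r i `^ t)); last first.
  rewrite -mulr_sumr; apply: (@le_trans _ _ (c%:R * e)).
    by rewrite ler_wpM2l // re // undup_uniq.
  by rewrite /e ler_pdivrMr // mul1r ler_nat; lia.
rewrite big_seq [leRHS]big_seq; apply: ler_sum => i il.
rewrite -big_mkcond big_const_seq iter_addr_0 -[leLHS]mulr_natl.
rewrite ler_wpM2r ?powR_ge0 // ler_nat -size_filter.
have Vi w : w \in [seq w <- A | i == g w] -> V i w.
  by rewrite mem_filter => /andP[/eqP -> /hg].
have ri : 0 < r i.
  by move: il; rewrite mem_undup => /mapP[w /hg Vw ->]; exact: rV Vw.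
apply: (hc (r i) _ _ (fun w => word_map f w x0) (x i)) => //.
- exact: filter_uniq.
- move=> w /Vi[d xd [[rw _] wd]].
  have := edist_coding_map hf d (size w) hD; rewrite -wd => wD.
  (* The path through [word_map f w x0], [word_map f w 0], [coding_map f d], [x i] has steps at most
     [edist x0 0 * r i], [D * r i] and [r i]. *)
  apply: le_trans (edist_triangle (word_map f w 0) _ _) _.
  rewrite (edist_word_map hf).
  apply: le_trans (lerD (lexx _) (edist_triangle (coding_map f d) _ _)) _.
  rewrite (edistC _ (x i)) addrA -addrA.
  have : word_ratio rho w * edist x0 0 <= edist x0 0 * r i.
    by rewrite mulrC ler_wpM2l ?edist_ge0.
  have : word_ratio rho w * D <= D * r i by rewrite mulrC ler_wpM2l.
  lra.
- move=> u v /Vi[_ _ [su _]] /Vi[_ _ [sv _]] uv.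
  (* Distinct stopping words are incomparable for the prefix order, hence separated, and their
     ratios are at least [min_ratio rho * r i]. *)
  apply: (@le_trans _ _ (word_ratio rho u * a)).
    rewrite mulrAC ler_wpM2r ?(ltW a0) //.
    by apply: stopping_word_ge => //; rewrite ri r1.
  apply: (word_map_separated hf fU fU0) => //.
    exact: stopping_word_prefixfree su sv uv.
  by apply: stopping_word_prefixfree sv su _; rewrite eq_sym.
Qed.

End LimitSet.

Theorem corollary4p1 (R : realType) (n N : nat)
  (f : 'I_N -> 'rV[R]_n -> 'rV[R]_n) (rho : 'I_N -> R)
  (hf : forall i, contracting_similarity (f i) (rho i))
  (C : set 'rV[R]_n) (hC0 : C !=set0) (hC : compact C)
  (hIOSC : IOSC f C)
  (S : set (code_space N)) (hS : compact S) (hSshift : shift_closed S)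
  (E : set 'rV[R]_n) (hE : sub_self_similar f E)
  (hES : E = coding_map f @` S)
  (s : R) (hs0 : 0 <= s) (hs : tau_seq rho S s k @[k --> \oo] --> (1 : R)) :
  hausdorff_dim (E `|` orbital_set f C S) =
    Order.max s%:E (hausdorff_dim C).
Proof.
have rho01 i : 0 < rho i < 1 := (hf i).1.
have [U [[U0 oU _] [fU fU0 _]]] := hIOSC.
apply/eqP; rewrite eq_le; apply/andP; split.
  have nullO t : 0 < t -> hausdorff_null t C ->
      hausdorff_null t (orbital_set f C S).
    move=> t0 nC; apply: hausdorff_nullU => //.
    (* [O] enumerates the images of [C] under all finite words; a number that codes no word yields
       [C], which is null too. *)
    pose O k := if @pickle_inv (seq 'I_N) k is Some w then word_map f w @` C else C.
    apply: (@hausdorff_null_sub _ _ _ _ (\bigcup_k O k)).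
      by move=> y [w _ Oy]; exists (pickle w) => //; rewrite /O pickleK_inv.
    apply: hausdorff_null_bigcup => // k; rewrite /O.
    case: pickle_inv => // w; apply: hausdorff_null_image => //.
    exact: edist_word_map_le hf w.
  have ub t : (Order.max s%:E (hausdorff_dim C) < t%:E)%E ->
      (hausdorff_dim (E `|` orbital_set f C S) <= t%:E)%E.
    rewrite gt_max lte_fin => /andP[st Ct].
    have t0 : 0 < t by exact: le_lt_trans st.
    apply: hausdorff_dim_le => //; apply: hausdorff_nullU => //.
      by rewrite hES; refine (@coding_map_null _ _ _ _ _ hf _ _ _ _ hs); rewrite hs0.
    exact/nullO/hausdorff_dim_lt_null.
  have : (s%:E <= Order.max s%:E (hausdorff_dim C))%E by rewrite le_max lexx.
  (* Being at least [s], the maximum is real or [+oo]; a real one is approached from above. *)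
  move: ub; case: (Order.max _ _) => [m| |] // ub _; last exact: leey.
  apply/lee_addgt0Pr => e e0; apply: ub.
  by rewrite lte_fin ltrDl.
apply: hausdorff_dim_ge.
  by have [y Cy] := hC0; exists y; right; left.
(* Both [E] and [C] inherit nullity at [t]: the first yields [s <= t], the second bounds
   [hausdorff_dim C] by [t]. *)
move=> t t0 nEO; rewrite ge_max; apply/andP; split.
  have nE : hausdorff_null t (coding_map f @` S).
    by apply: hausdorff_null_sub nEO => y; rewrite hES; left.
  have [M hM] := coding_map_null_word_sum_bounded hf U0 oU fU fU0 hS hSshift t0 nE.
  by rewrite lee_fin; exact: (tau_le_of_word_sum_bounded rho01 hs hM).
apply: hausdorff_dim_le => //.
by apply: hausdorff_null_sub nEO => y Cy; right; left.
Qed.
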